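(* For every $k\geq 0$, the polynomial $H_k(x)$ is unimodal, i.e. its sequence of coefficients is unimodal.
   Context: $B_n(y)=\sum_{\pi\in B_n}y^{\mathrm{des}_B(\pi)}$ is the type $B$ Eulerian polynomial: $B_n$ is the set of signed permutations $\pi_1\cdots\pi_n$ of $[n]$, and with $\pi_0=0$, $\mathrm{des}_B(\pi)$ counts $i\in\{0,\dots,n-1\}$ with $\pi_i>\pi_{i+1}$; $B_0=1$. Define \[H_k(x)=\sum_{l=0}^{k}B_{k-l}(x^{2k+2})(x^{2k+2}-1)^l\sum_{s=l}^{k}\binom{s}{l}x^{2k+1-s}+\sum_{l=0}^{k}B_{k-l}(x^{-2k-2})(x^{-2k-2}-1)^l\sum_{s=l}^{k}\binom{s}{l}x^{2(k+1)^2+s}.\] A sequence $s_1,\dots,s_m$ is unimodal if there is $t$ with $s_1\le\cdots\le s_t\ge s_{t+1}\ge\cdots\ge s_m$. *)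

(* Defs.v *)
From HB Require Import structures.
From mathcomp Require Import all_boot all_order all_algebra all_fingroup.
Set Implicit Arguments. Unset Strict Implicit. Unset Printing Implicit Defensive.
Import Order.TTheory GRing.Theory Num.Theory.
Local Open Scope ring_scope.

(* A signed permutation of [n]: a permutation sigma of 'I_n (i.e. of {1..n},
   shifted by one) together with a sign for each position.  The word is
   pi_1 ... pi_n with pi_j = (+/-) (sigma (j-1) + 1); sign true = negative. *)
Definition signed_perm (n : nat) := ('S_n * {ffun 'I_n -> bool})%type.

Definition spval (n : nat) (p : signed_perm n) (j : nat) : int :=
  match j with
  | 0%N => 0
  | j'.+1 =>
      match (insub j' : option 'I_n) with
      | Some i => (if p.2 i then -1 else 1) * ((p.1 i).+1)%:Z
      | None => 0
      end
  end.

Definition desB (n : nat) (p : signed_perm n) : nat :=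
  count (fun i => spval p i.+1 < spval p i) (iota 0 n).

Definition EulerB (n : nat) (y : rat) : rat :=
  \sum_(p : signed_perm n) y ^+ desB p.

(* H_k(x) evaluated at a nonzero rational x (negative powers are x ^- m) *)
Definition Hk (k : nat) (x : rat) : rat :=
  \sum_(l < k.+1)
     EulerB (k - l) (x ^+ (2 * k + 2)) * (x ^+ (2 * k + 2) - 1) ^+ l *
     \sum_(l <= s < k.+1) 'C(s, l)%:R * x ^+ (2 * k + 1 - s)
  + \sum_(l < k.+1)
     EulerB (k - l) (x ^- (2 * k + 2)) * (x ^- (2 * k + 2) - 1) ^+ l *
     \sum_(l <= s < k.+1) 'C(s, l)%:R * x ^+ (2 * (k + 1) ^ 2 + s).

Definition unimodal (s : seq int) : Prop :=
  exists t : nat,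
    (forall i : nat, (i < t)%N -> (i.+1 < size s)%N -> s`_i <= s`_i.+1) /\
    (forall i : nat, (t <= i)%N -> (i.+1 < size s)%N -> s`_i.+1 <= s`_i).

(* Main.v *)
Require Import Defs.
From HB Require Import structures.
From mathcomp Require Import all_boot all_order all_algebra all_fingroup.
From mathcomp Require Import zify ring.
Import Order.TTheory GRing.Theory Num.Theory.
Local Open Scope ring_scope.

(* Set R_(z,k,s) = sum_l C(s,l) B_(k-l)(y) z^l.  As B_n is palindromic, H_k is
   the sum of x^(2k+1-s) R_(y-1,k,s) and x^s y R_(1-y,k,s) over s <= k, with
   y = x^(2k+2): every residue of the exponent mod 2k+2 occurs exactly once.
   Pascal's rule R_(z,k+1,s+1) = R_(z,k+1,s) + z R_(z,k,s) and, at the seam,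
   R_(y-1,k,k) = y R_(1-y,k,k) (k > 0) then say that the difference of two
   consecutive coefficients of H_(k+1) is either zero or h(M) - h(M-2k-2), where
   h is the coefficient sequence of H_k and M grows with the exponent.  Such
   windowed differences of a nonnegative unimodal h change sign at most once, so
   unimodality is inherited by H_(k+1).  The seam identity follows by induction
   from B_(n+1) = (1 + (2n+1)y) B_n + 2y(1-y) B_n', obtained by inserting the
   letter n+1 or -(n+1) into a signed permutation of [n]. *)

(** * The recurrence for B_n by inserting a letter *)

Definition ndes (w : nat -> int) (n : nat) : nat :=
  (\sum_(0 <= j < n) (w j.+1 < w j)%R)%N.

Lemma desBE (n : nat) (p : signed_perm n) : desB p = ndes (spval p) n.
Proof.
rewrite /desB /ndes -sum1_count big_mkcond /index_iota subn0.
by apply: eq_bigr => j _; case: (_ < _).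
Qed.

Definition insert_word (w : nat -> int) (i : nat) (v : int) (j : nat) : int :=
  if (j <= i)%N then w j else if j == i.+1 then v else w j.-1.

(** Insertion destroys the pair at [i] and creates two pairs. The destroyed pair is counted on the
    left to avoid truncated subtraction; the factor [i < n] reflects that the last slot has no right
    neighbour. *)
Lemma ndes_insert (w : nat -> int) (n i : nat) (v : int) : (i <= n)%N ->
  (ndes (insert_word w i v) n.+1 + (i < n)%N * (w i.+1 < w i)%R =
   ndes w n + (v < w i)%R + (i < n)%N * (w i.+1 < v)%R)%N.
Proof.
move=> le_in; rewrite /ndes.
have insl j : (j <= i)%N -> insert_word w i v j = w j.
  by rewrite /insert_word => ->.
have insv : insert_word w i v i.+1 = v.
  by rewrite /insert_word ltnn eqxx.
have insr j : (i < j)%N -> insert_word w i v j.+1 = w j.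
  move=> lt_ij; rewrite /insert_word eqSS ifF ?ifF //; last by apply/negbTE; lia.
  by apply/negbTE; lia.
have low : (\sum_(0 <= j < i) (insert_word w i v j.+1 < insert_word w i v j)%R
            = \sum_(0 <= j < i) (w j.+1 < w j)%R)%N.
  by apply: eq_big_nat => j /andP[_ ltji]; rewrite !insl // ltnW.
rewrite (@big_cat_nat _ _ _ i) /=; [|lia|lia].
rewrite low big_nat_recl //= insv insl //.
rewrite [X in (_ = X + _ + _)%N](@big_cat_nat _ _ _ i) //=.
move: le_in; rewrite leq_eqVlt => /predU1P[<- | lt_in].
  rewrite ltnn (@big_geq _ _ _ i i) // (@big_geq _ _ _ i i) //; lia.
rewrite lt_in !mul1n.
rewrite [X in (_ + (_ + X) + _)%N]big_ltn // [X in (_ = _ + X + _ + _)%N]big_ltn //.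
rewrite insr // insv.
have -> : (\sum_(i.+1 <= j < n) (insert_word w i v j.+2 < insert_word w i v j.+1)%R
          = \sum_(i.+1 <= j < n) (w j.+1 < w j)%R)%N.
  by apply: eq_big_nat => j /andP[ltij _]; rewrite !insr // ltnW.
lia.
Qed.

Definition insert_max (n : nat) (u : 'I_n.+1 * bool * signed_perm n) :
    signed_perm n.+1 :=
  (lift_perm u.1.1 ord_max u.2.1,
   [ffun j => if unlift u.1.1 j is Some j' then u.2.2 j' else u.1.2]).

(** Injectivity suffices, as both sides have 2^(n+1) (n+1)! elements. *)
Lemma insert_max_bij (n : nat) : bijective (@insert_max n).
Proof.
apply: inj_card_bij => [[[i b] [s e]] [[i' b'] [s' e']] [] /= Es Ee|].
  have Ei : i = i'.
    apply: (@perm_inj _ (lift_perm i ord_max s)).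
    by rewrite lift_perm_id Es lift_perm_id.
  subst i'; congr (_, _, (_, _)).
  - by move/ffunP/(_ i): Ee; rewrite !ffunE unlift_none.
  - apply/permP => j; apply: (@lift_inj _ ord_max).
    by rewrite -(lift_perm_lift i) Es lift_perm_lift.
  - by apply/ffunP => j; move/ffunP/(_ (lift i j)): Ee; rewrite !ffunE liftK.
rewrite !card_prod !card_Sn !card_ffun !card_ord card_bool factS expnS.
by apply: eq_leq; ring.
Qed.

Lemma spvalE (n : nat) (p : signed_perm n) (i : 'I_n) :
  spval p i.+1 = (if p.2 i then -1 else 1) * ((p.1 i).+1)%:Z.
Proof. by rewrite /= valK. Qed.

Lemma spval_insert_max (n : nat) (i : 'I_n.+1) (b : bool) (p : signed_perm n)
    (j : nat) : (j <= n.+1)%N ->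
  spval (insert_max n (i, b, p)) j =
  insert_word (spval p) i (if b then - (n.+1)%:Z else (n.+1)%:Z) j.
Proof.
case: j => [|j] ltjn; first by rewrite /insert_word.
pose o : 'I_n.+1 := Ordinal ltjn.
rewrite -[j]/(val o) spvalE /insert_word /= !ffunE.
case: unliftP => [o' | ] Eo /=.
  have Ej : j = bump i o' by rewrite -[j]/(val o) Eo.
  rewrite Eo lift_perm_lift lift_max Ej /bump -spvalE.
  case: (leqP i o') => h /=.
    by rewrite add1n eqSS gtn_eqF // ltnNge leqW.
  by rewrite add0n h.
have Ej : j = i by rewrite -[j]/(val o) Eo.
rewrite Eo lift_perm_id Ej ltnn eqxx /=.
by case: b; lia.
Qed.

Lemma spval_bound (n : nat) (p : signed_perm n) (j : nat) :
  - (n.+1)%:Z < spval p j < (n.+1)%:Z.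
Proof.
case: j => [|j] /=; first by lia.
case: insubP => [i _ _|_]; last by lia.
by have := ltn_ord (p.1 i); case: (p.2 i); lia.
Qed.

(** The letter n+1 or -(n+1) lies beyond all others: between two letters it makes exactly one
    descent whatever its sign, and at the end it makes one iff it is negative. *)
Lemma desB_insert_max (n : nat) (i : 'I_n.+1) (b : bool) (p : signed_perm n) :
  desB (insert_max n (i, b, p)) =
  if (i < n)%N then (desB p + ~~ (spval p i.+1 < spval p i)%R)%N
  else (desB p + b)%N.
Proof.
rewrite !desBE.
pose v := if b then - (n.+1)%:Z else (n.+1)%:Z.
have -> : ndes (spval (insert_max n (i, b, p))) n.+1 =
          ndes (insert_word (spval p) i v) n.+1.
  by apply: eq_big_nat => j /andP[_ ltj]; rewrite !spval_insert_max // ltnW.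
have lein : (i <= n)%N by rewrite -ltnS.
have := ndes_insert (spval p) n i v lein.
have -> : (v < spval p i) = b.
  by have := spval_bound n p i; rewrite /v; case: (b); lia.
have -> : (spval p i.+1 < v) = ~~ b.
  by have := spval_bound n p i.+1; rewrite /v; case: (b); lia.
by case: ifP => _; case: (_ < _); case: (b); lia.
Qed.

Definition polyB (n : nat) : {poly int} := \sum_(p : signed_perm n) 'X^(desB p).

Definition stepB (n : nat) (f : {poly int}) : {poly int} :=
  (1 + (2 * n + 1)%:R * 'X) * f + 2%:R * 'X * (1 - 'X) * f^`().

(** Of the 2n+2 insertions into a word with d descents, 2d+1 keep d and 2n+1-2d raise it to d+1. *)
Lemma stepB_Xn (n d : nat) :
  stepB n 'X^d = (2 * d + 1)%:R * 'X^d + ((2 * n + 1)%:R - (2 * d)%:R) * 'X^(d.+1).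
Proof.
rewrite /stepB derivXn -(mulr_natl 'X^_); case: d => [|d] /=; rewrite !exprS; ring.
Qed.

Lemma stepB_sum (n : nat) (I : Type) (r : seq I) (P : pred I)
    (F : I -> {poly int}) :
  stepB n (\sum_(i <- r | P i) F i) = \sum_(i <- r | P i) stepB n (F i).
Proof. by rewrite /stepB raddf_sum !mulr_sumr big_split. Qed.

Lemma polyB_rec (n : nat) : polyB n.+1 = stepB n (polyB n).
Proof.
rewrite /polyB (reindex _ (onW_bij _ (insert_max_bij n))) /= stepB_sum.
rewrite -(pair_bigA _ (fun ib p => 'X^(desB (insert_max n (ib, p))))) /=.
rewrite exchange_big; apply: eq_bigr => p _.
rewrite -(pair_bigA _ (fun i b => 'X^(desB (insert_max n (i, b, p))))) /=.
rewrite stepB_Xn big_ord_recr /= big_bool /= !desB_insert_max /= ltnn addn0 addn1.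
pose c := (fun j => spval p j.+1 < spval p j).
have -> : \sum_(i < n) \sum_b 'X^(desB (insert_max n (widen_ord (leqnSn n) i, b, p)))
    = \sum_(i < n) (2%:R * 'X^((desB p).+1)
          + (c i : nat)%:R * (2%:R * ('X^(desB p) - 'X^((desB p).+1)))) :> {poly int}.
  apply: eq_bigr => i _; rewrite big_bool !desB_insert_max /= ltn_ord /c.
  by case: (_ < _); rewrite ?addn1 ?addn0 /=; ring.
rewrite big_split /= sumr_const card_ord -mulr_suml -natr_sum.
have -> : (\sum_(i < n) c i)%N = desB p by rewrite desBE /ndes big_mkord.
rewrite -mulr_natl; ring.
Qed.

Lemma polyB0 : polyB 0 = 1.
Proof.
rewrite /polyB (eq_bigr (fun=> 1)) // sumr_const.
by rewrite card_prod card_Sn card_ffun card_ord.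
Qed.

Lemma EulerB_horner (n : nat) (y : rat) :
  EulerB n y = (map_poly (intr : int -> rat) (polyB n)).[y].
Proof.
rewrite /polyB rmorph_sum /= horner_sum; apply: eq_bigr => p _.
by rewrite map_polyXn hornerXn.
Qed.

(** * Palindromicity of B_n by reversing signs *)

Lemma spval_abs (n : nat) (p : signed_perm n) (i : 'I_n) :
  `|spval p i.+1|%N = (p.1 i).+1.
Proof. by rewrite spvalE; case: (p.2 i); lia. Qed.

Lemma spval_neq (n : nat) (p : signed_perm n) (j : nat) : (j < n)%N ->
  spval p j.+1 != spval p j.
Proof.
move=> ltjn; apply/eqP => E.
have := spval_abs n p (Ordinal ltjn); rewrite [spval p _]E.
case: j ltjn E => [|j] // ltjn _.
rewrite [spval p _](_ : _ = spval p (Ordinal (ltnW ltjn)).+1) // spval_abs.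
by case=> /val_inj/perm_inj/(congr1 val) /=; lia.
Qed.

Definition flip_signs (n : nat) (p : signed_perm n) : signed_perm n :=
  (p.1, [ffun i => ~~ p.2 i]).

Lemma flip_signsK (n : nat) : involutive (@flip_signs n).
Proof.
by case=> s e; congr (_, _); apply/ffunP => i; rewrite !ffunE negbK.
Qed.

Lemma spval_flip (n : nat) (p : signed_perm n) (j : nat) :
  spval (flip_signs n p) j = - spval p j.
Proof.
case: j => [|j] /=; first by rewrite oppr0.
case: insub => [i|]; last by rewrite oppr0.
by rewrite ffunE; case: (p.2 i) => /=; lia.
Qed.

(** Negating all letters exchanges ascents and descents, and adjacent letters are never equal. *)
Lemma desB_flip (n : nat) (p : signed_perm n) :
  (desB (flip_signs n p) + desB p = n)%N.
Proof.
rewrite !desBE /ndes -big_split.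
rewrite (eq_big_nat _ _ (F2 := fun=> 1%N)) => [|j /andP[_ ltjn]].
  by rewrite sum_nat_const_nat subn0 muln1.
rewrite !spval_flip ltrN2.
by case: ltgtP (spval_neq n p j ltjn) => // ->; rewrite eqxx.
Qed.

Lemma EulerB_inv (n : nat) (y : rat) : y != 0 ->
  y ^+ n * EulerB n y^-1 = EulerB n y.
Proof.
move=> y0; rewrite [RHS](reindex_inj (inv_inj (flip_signsK n))) /=.
rewrite mulr_sumr; apply: eq_bigr => p _.
by rewrite -{1}(desB_flip n p) exprD exprVn mulfK // expf_neq0.
Qed.

(** * The polynomials R_(z,k,s) *)

Definition refinedB (z : {poly int}) (k s : nat) : {poly int} :=
  \sum_(l < k.+1) 'C(s, l)%:R * (polyB (k - l) * z ^+ l).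

Lemma refinedB0 (z : {poly int}) (k : nat) : refinedB z k 0 = polyB k.
Proof.
rewrite /refinedB big_ord_recl big1 ?addr0 /=.
  by rewrite bin0 subn0 expr0 mul1r mulr1.
by move=> i _; rewrite /bump /= bin0n mul0r.
Qed.

Lemma refinedB_pascal (z : {poly int}) (k s : nat) :
  refinedB z k.+1 s.+1 = refinedB z k.+1 s + z * refinedB z k s.
Proof.
rewrite /refinedB big_ord_recl [X in _ = X + _]big_ord_recl /= !bin0 -addrA.
congr (_ + _); rewrite mulr_sumr -big_split; apply: eq_bigr => i _ /=.
by rewrite /bump /= add1n binS natrD subSS exprS; ring.
Qed.

(* The hypothesis on [z] covers both [1 - 'X] and ['X - 1]. *)
Lemma stepB_refinedB (z : {poly int}) (k s : nat) :
  (s <= k)%N -> (1 - 'X) * z^`() = - z ->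
  stepB k (refinedB z k s) = refinedB z k.+1 s.
Proof.
move=> lesk Ez; rewrite /refinedB [RHS]big_ord_recr /= bin_small // mul0r addr0.
rewrite stepB_sum; apply: eq_bigr => -[l /= lelk] _.
rewrite subSn // polyB_rec.
move: (k - l)%N (subnK (lelk : l <= k)%N) => d Ek; rewrite -{}Ek /stepB.
rewrite [_^`()](_ : _ = 'C(s, l)%:R * (polyB d * z ^+ l)^`()); last first.
  by rewrite !mulr_natl derivMn.
rewrite derivM deriv_exp.
case: l {lelk} => [|m] /=; first by rewrite expr0 mulr0n addn0; ring.
have -> : (2 * (d + m.+1) + 1)%:R = (2 * d + 1)%:R + 2%:R * m.+1%:R :> {poly int}.
  by rewrite -natrM -natrD; congr (_%:R); lia.
rewrite -(mulr_natl (_ * _)) exprS.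
move: (m.+1%:R) ('C(_, _)%:R) ((2 * d + 1)%:R) => a c e.
(* Regrouped so that the derivative of [z] occurs only in the product governed by [Ez]. *)
transitivity (c * (((1 + (e + 2%:R * a) * 'X) * polyB d
   + 2%:R * 'X * (1 - 'X) * (polyB d)^`()) * (z * z ^+ m)
   + 2%:R * 'X * a * polyB d * z ^+ m * ((1 - 'X) * z^`()))); first by ring.
rewrite Ez; ring.
Qed.

(** * Unimodal sequences and windowed differences *)

Definition quasi_concave (h : nat -> int) : Prop :=
  forall a b c : nat, (a <= b <= c)%N -> h a <= h b \/ h c <= h b.

(** Unimodality without naming a mode, convenient for the induction on k. *)
Definition descents_persist (h : nat -> int) : Prop :=
  forall i j : nat, (i <= j)%N -> h i.+1 < h i -> h j.+1 <= h j.

Lemma descent_exists (h : nat -> int) (a b : nat) : (a <= b)%N -> h b < h a ->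
  exists i, (a <= i < b)%N /\ h i.+1 < h i.
Proof.
elim: b => [|b IH]; first by rewrite leqn0 => /eqP->; rewrite ltxx.
rewrite leq_eqVlt => /predU1P[-> | leab hba]; first by rewrite ltxx.
have [hb | hb] := ltP (h b.+1) (h b); first by exists b; split=> //; lia.
have [i [abi hi]] := IH leab (le_lt_trans hb hba).
by exists i; split=> //; lia.
Qed.

Lemma descents_persist_concave (h : nat -> int) :
  descents_persist h -> quasi_concave h.
Proof.
move=> dh a b c /andP[leab lebc].
have [|hba] := leP (h a) (h b); [by left | right].
have [i [/andP[_ ltib] hi]] := descent_exists h a b leab hba.
elim: c lebc => [|c IH]; first by rewrite leqn0 => /eqP->.
rewrite leq_eqVlt => /predU1P[-> // | lebc].
by apply: le_trans (IH lebc); apply: dh hi; lia.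
Qed.

Lemma descents_persist_unimodal (s : seq int) :
  descents_persist (fun i => s`_i) -> unimodal s.
Proof.
move=> ds; pose a := fun i => s`_i.+1 < s`_i.
(* The mode is the first strict descent, or [size s] if there is none. *)
exists (find a (iota 0 (size s))); split=> i hi lti.
  have := before_find 0 hi; rewrite nth_iota ?add0n /a; last by lia.
  by move/negbT; rewrite -leNgt.
have ha : has a (iota 0 (size s)) by rewrite has_find size_iota; lia.
have lt_f : (find a (iota 0 (size s)) < size s)%N.
  by rewrite -[X in (_ < X)%N](size_iota 0) -has_find.
have := nth_find 0 ha; rewrite nth_iota // add0n.
exact: ds.
Qed.

(* The windowed differences of a unimodal sequence change sign only once: while
   the window straddles the mode, [h j] decreases and [h (j - L)] increases. *)
Lemma window_sign (h : nat -> int) (L i j : nat) :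
  quasi_concave h -> (forall i, 0 <= h i) -> (i <= j)%N ->
  h i < (if (i < L)%N then 0 else h (i - L)%N) ->
  h j <= (if (j < L)%N then 0 else h (j - L)%N).
Proof.
move=> qh h0 leij.
case: ltnP => [_ | leLi]; first by rewrite ltNge h0.
move=> hi; rewrite ifF; last by apply/negbTE; lia.
have q1 : h (i - L)%N <= h i \/ h j <= h i by apply: qh; lia.
have [leji | ltij] := leqP (j - L)%N i.
  have q2 : h (i - L)%N <= h (j - L)%N \/ h i <= h (j - L)%N by apply: qh; lia.
  by case: q1 q2 => [?|?] [?|?]; lia.
(* Disjoint windows: here [h (j - L) <= h i < h (i - L)], so [h] cannot rise from [j - L] to [j]. *)
have q2 : h (i - L)%N <= h i \/ h (j - L)%N <= h i by apply: qh; lia.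
have q3 : h (i - L)%N <= h (j - L)%N \/ h j <= h (j - L)%N by apply: qh; lia.
by case: q2 q3 => [?|?] [?|?]; lia.
Qed.

(** * The seam identity and the coefficients of H_k *)

(* The operator [stepB k.+1] maps level [k.+1] to level [k.+2] on both sides,
   which reduces the induction step to a polynomial identity. *)
Lemma refinedB_top (k : nat) :
  refinedB ('X - 1) k.+1 k.+1 = 'X * refinedB (1 - 'X) k.+1 k.+1.
Proof.
have EA : (1 - 'X) * ('X - 1 : {poly int})^`() = - ('X - 1).
  by rewrite derivB derivX derivC; ring.
have EC : (1 - 'X) * (1 - 'X : {poly int})^`() = - (1 - 'X).
  by rewrite derivB derivX derivC; ring.
elim: k => [|k IH].
  rewrite !refinedB_pascal !refinedB0 polyB_rec polyB0 /stepB derivC; ring.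
rewrite refinedB_pascal [in RHS]refinedB_pascal -!(stepB_refinedB _ k.+1) // IH.
rewrite /stepB derivM derivX.
have -> : (2 * k.+1 + 1)%:R = 2%:R * k.+1%:R + 1 :> {poly int}.
  by rewrite natrD natrM.
ring.
Qed.

(* The part of [H_k] with exponents congruent to [t] modulo [2k + 2], for
   [t < 2k + 2]. *)
Definition column (k t : nat) : {poly int} :=
  if (t <= k)%N then 'X * refinedB (1 - 'X) k t
  else refinedB ('X - 1) k (2 * k + 1 - t).

Definition polyH (k : nat) : {poly int} :=
  \sum_(t < 2 * k + 2) 'X^t * (column k t \Po 'X^(2 * k + 2)).

(** The summand of index t only has exponents congruent to t modulo M. *)
Lemma coef_interleave (M N : nat) (q : nat -> {poly int}) : (0 < M)%N ->
  (\sum_(t < M) 'X^t * (q t \Po 'X^M))`_N = (q (N %% M)%N)`_(N %/ M)%N.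
Proof.
move=> M0; rewrite coef_sum.
have ltM : (N %% M < M)%N by rewrite ltn_mod.
rewrite (bigD1 (Ordinal ltM)) //= big1 ?addr0.
  rewrite coefXnM ltnNge leq_mod /= coef_comp_poly_Xn //.
  have -> : (N - N %% M = N %/ M * M)%N by rewrite {1}(divn_eq N M) addnK.
  by rewrite dvdn_mull // mulnK.
move=> t /eqP net; rewrite coefXnM coef_comp_poly_Xn //.
case: ltnP => // letN; case: ifP => // /dvdnP[d Ed]; case: net.
apply: val_inj => /=; rewrite -(subnK letN) Ed modnMDl modn_small //.
Qed.

Lemma coef_polyH (k N : nat) :
  (polyH k)`_N = (column k (N %% (2 * k + 2))%N)`_(N %/ (2 * k + 2))%N.
Proof. by apply: coef_interleave; rewrite addn2. Qed.

(** Of the 2k+3 steps between the 2k+4 columns of level k+1, all but the seam at [k.+1] match the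
    2k+2 columns of level k, in order. *)
Lemma column_diff (k t : nat) : (t < 2 * k + 3)%N -> t != k.+1 ->
  column k.+1 t.+1 - column k.+1 t =
  (1 - 'X) * column k (if (t <= k)%N then t else t.-1).
Proof.
move=> ltt net; rewrite /column; have [letk | ltkt] := leqP t k.
  by rewrite ltnS letk leqW // refinedB_pascal; ring.
rewrite !ifF; try by apply/negbTE; lia.
have -> : (2 * k.+1 + 1 - t = (2 * k + 1 - t.-1).+1)%N by lia.
have -> : (2 * k.+1 + 1 - t.+1 = 2 * k + 1 - t.-1)%N by lia.
rewrite refinedB_pascal; ring.
Qed.

(** The zero differences sit at N congruent to k+1 modulo k+2; [M] is the rank of N once these are
    deleted. The factor 1 - X of [column_diff] becomes the shift by 2k+2. *)
Lemma polyH_diff (k N : nat) :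
  let M := (N - N %/ k.+2)%N in
  (polyH k.+1)`_N.+1 = (polyH k.+1)`_N \/
  (polyH k.+1)`_N.+1 - (polyH k.+1)`_N =
  (polyH k)`_M - (if (M < 2 * k + 2)%N then 0 else (polyH k)`_(M - (2 * k + 2))%N).
Proof.
have [j [t [ltt EN]]] : exists j t, (t < 2 * k + 4)%N /\ N = (j * (2 * k + 4) + t)%N.
  exists (N %/ (2 * k + 4))%N, (N %% (2 * k + 4))%N.
  by rewrite ltn_mod -divn_eq; split=> //; lia.
have H1 j' t' : (t' < 2 * k + 4)%N ->
    (polyH k.+1)`_(j' * (2 * k + 4) + t') = (column k.+1 t')`_j'.
  move=> lt'; rewrite coef_polyH (_ : 2 * k.+1 + 2 = 2 * k + 4)%N; last by lia.
  by rewrite modnMDl modn_small // divnMDl ?divn_small ?addn0 //; lia.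
have H0 j' t' : (t' < 2 * k + 2)%N ->
    (polyH k)`_(j' * (2 * k + 2) + t') = (column k t')`_j'.
  move=> lt'; rewrite coef_polyH.
  by rewrite modnMDl modn_small // divnMDl ?divn_small ?addn0 //; lia.
move=> M; rewrite EN -addnS; have [ltt1 | let1] := ltnP t.+1 (2 * k + 4); last first.
  (* Wrap-around: the last column is B_(k+1) and column 0 is X B_(k+1), read one degree higher. *)
  left; have -> : (j * (2 * k + 4) + t.+1 = j.+1 * (2 * k + 4) + 0)%N by lia.
  rewrite !H1 //; last by lia.
  rewrite /column ifF; last by apply/negbTE; lia.
  by rewrite (_ : 2 * k.+1 + 1 - t = 0)%N ?refinedB0 ?coefXM //; lia.
rewrite !H1 //.
have [Et | net] := eqVneq t k.+1; first left.
  rewrite Et /column leqnn ifF ?ltnn //.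
  by rewrite (_ : 2 * k.+1 + 1 - k.+2 = k.+1)%N ?refinedB_top //; lia.
right; rewrite -coefB column_diff //; last by lia.
pose t' := if (t <= k)%N then t else t.-1.
have lt' : (t' < 2 * k + 2)%N by rewrite /t'; case: ifP; lia.
have EM : M = (j * (2 * k + 2) + t')%N.
  rewrite /M EN (_ : j * (2 * k + 4) + t = 2 * j * k.+2 + t)%N; last by lia.
  rewrite divnMDl // /t'; case: leqP => h.
    by rewrite divn_small; lia.
  by rewrite (_ : t = 1 * k.+2 + (t - k.+2))%N ?divnMDl // ?divn_small; lia.
rewrite -/t' EM H0 // mulrBl mul1r coefB coefXM.
case: j {EN} EM => [|j] EM; first by rewrite mul0n add0n lt'.
rewrite ifF; last by apply/negbTE; lia.
by rewrite (_ : _ - _ = j * (2 * k + 2) + t')%N ?H0 //=; lia.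
Qed.

(** The sequence vanishes at 0 and beyond the degree, and no value in between can lie below both
    ends. *)
Lemma polyH_ge0 (k N : nat) :
  quasi_concave (fun i => (polyH k)`_i) -> 0 <= (polyH k)`_N.
Proof.
move=> qH; have H00 : (polyH k)`_0 = 0.
  by rewrite coef_polyH mod0n div0n /column coefXM.
have [||] := qH 0%N N (N + size (polyH k))%N; first by lia.
  by rewrite H00.
by rewrite [X in X <= _]nth_default // leq_addl.
Qed.

Lemma polyH0 : polyH 0 = 'X + 'X^2.
Proof.
rewrite /polyH !big_ord_recl big_ord0 /column /= !refinedB0 polyB0 !mulr1.
by rewrite comp_polyX comp_polyC /bump /= expr0 expr1 mul1r mulr1 addr0 addrC.
Qed.

Lemma polyH_descents (k : nat) : descents_persist (fun i => (polyH k)`_i).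
Proof.
elim: k => [|k /descents_persist_concave qH] i j leij.
  rewrite polyH0 !coefD !coefX !coefXn.
  by case: i j leij => [|[|i]] [|[|[|j]]].
have h0 N := polyH_ge0 k N qH.
case: (polyH_diff k i) => [-> | /= Di]; first by rewrite ltxx.
case: (polyH_diff k j) => [-> // | /= Dj].
rewrite -subr_lt0 -subr_le0 Di Dj subr_lt0 subr_le0.
apply: (window_sign _ _ _ _ qH h0).
(* The rank [M] is nondecreasing in N, so [window_sign] applies. *)
have mono N : (N - N %/ k.+2 <= N.+1 - N.+1 %/ k.+2)%N; last first.
  pose f N := (N - N %/ k.+2)%N.
  exact: (@homo_leq _ f leq leqnn (@leq_trans) mono _ _ leij).
by rewrite divnS //; case: (_ %| _)%N; have := leq_div N k.+2; lia.
Qed.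

(** * Evaluation at a nonzero rational *)

Lemma refinedB_horner (z : {poly int}) (k s : nat) (y w : rat) :
  (map_poly (intr : int -> rat) z).[y] = w ->
  (map_poly (intr : int -> rat) (refinedB z k s)).[y] =
  \sum_(l < k.+1) 'C(s, l)%:R * (EulerB (k - l) y * w ^+ l).
Proof.
move=> Ew; rewrite /refinedB rmorph_sum /= horner_sum; apply: eq_bigr => l _.
by rewrite !rmorphM rmorphXn rmorph_nat /= !hornerE -EulerB_horner Ew hornerMn hornerC.
Qed.

Lemma refinedB_sum (k : nat) (c : nat -> rat) (b : nat -> rat) :
  \sum_(l < k.+1) b l * \sum_(l <= s < k.+1) 'C(s, l)%:R * c s =
  \sum_(s < k.+1) c s * \sum_(l < k.+1) 'C(s, l)%:R * b l.
Proof.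
transitivity (\sum_(l < k.+1) \sum_(s < k.+1) b l * ('C(s, l)%:R * c s)).
  apply: eq_bigr => l _; rewrite mulr_sumr.
  rewrite -(big_mkord xpredT (fun s => b l * ('C(s, l)%:R * c s))).
  rewrite (@big_cat_nat _ _ _ l 0 k.+1) //=; last exact: ltnW.
  rewrite [X in _ = X + _](_ : _ = 0) ?add0r // big_nat_cond big1 // => s.
  by rewrite andbT => /andP[_ lts]; rewrite bin_small // mul0r mulr0.
rewrite exchange_big; apply: eq_bigr => s _; rewrite mulr_sumr.
by apply: eq_bigr => l _; ring.
Qed.

Lemma polyH_horner (k : nat) (x : rat) : x != 0 ->
  (map_poly (intr : int -> rat) (polyH k)).[x] = Hk k x.
Proof.
move=> x0; rewrite /Hk; set M := (2 * k + 2)%N; set y := x ^+ M.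
have y0 : y != 0 by rewrite expf_neq0.
have ev (q : {poly int}) : (map_poly (intr : int -> rat) (q \Po 'X^M)).[x] =
    (map_poly (intr : int -> rat) q).[y].
  by rewrite map_comp_poly map_polyXn horner_comp hornerXn.
have evA : (map_poly (intr : int -> rat) ('X - 1)).[y] = y - 1.
  by rewrite rmorphB rmorph1 /= map_polyX !hornerE.
have evC : (map_poly (intr : int -> rat) (1 - 'X)).[y] = 1 - y.
  by rewrite rmorphB rmorph1 /= map_polyX !hornerE.
rewrite /polyH rmorph_sum /= horner_sum.
pose F t := x ^+ t * (map_poly (intr : int -> rat) (column k t)).[y].
rewrite (eq_bigr (fun t : 'I_M => F t)) => [|t _]; last first.
  by rewrite rmorphM /= map_polyXn hornerM hornerXn ev.
rewrite -(big_mkord xpredT F) {}/F.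
rewrite (@big_cat_nat _ _ _ k.+1) /=; [|lia|lia].
(* Columns above k give the first sum of H_k, after the reversal of t; columns up to k give the
   second. *)
rewrite addrC; congr (_ + _).
  rewrite (refinedB_sum k (fun s => x ^+ (2 * k + 1 - s))
    (fun l => EulerB (k - l) y * (y - 1) ^+ l)).
  rewrite big_nat_rev /= -{1}[k.+1]add0n big_addn.
  rewrite (_ : 2 * k + 2 - k.+1 = k.+1)%N; last by lia.
  rewrite big_mkord; apply: eq_bigr => -[s /= lts] _.
  rewrite (_ : k.+1 + (2 * k + 2) - (s + k.+1).+1 = 2 * k + 1 - s)%N; last by lia.
  rewrite /column ifF; last by apply/negbTE; lia.
  rewrite (_ : 2 * k + 1 - (2 * k + 1 - s) = s)%N; last by lia.
  by rewrite (refinedB_horner _ _ _ _ _ evA).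
rewrite (refinedB_sum k (fun s => x ^+ (2 * (k + 1) ^ 2 + s))
  (fun l => EulerB (k - l) y^-1 * (y^-1 - 1) ^+ l)).
rewrite big_mkord; apply: eq_bigr => -[s /= lts] _.
rewrite /column -ltnS lts rmorphM /= map_polyX hornerM hornerX.
rewrite (refinedB_horner _ _ _ _ _ evC).
(* Since 2(k+1)^2 = (2k+2)(k+1), the power is x^s y^(k+1). Below, y^k splits as y^(k-l) y^l to clear
   1/y from B_(k-l) and from (1/y - 1)^l. *)
have -> : x ^+ (2 * (k + 1) ^ 2 + s) = x ^+ s * (y * y ^+ k).
  by rewrite /y -exprS -exprM -exprD; congr (_ ^+ _); rewrite /M; lia.
rewrite -!mulrA; congr (_ * (_ * _)); rewrite mulr_sumr.
apply: eq_bigr => -[l /= ltl] _.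
rewrite -(EulerB_inv (k - l) y y0).
have -> : y ^+ k = y ^+ (k - l) * y ^+ l by rewrite -exprD subnK.
have -> : (1 - y) ^+ l = y ^+ l * (y^-1 - 1) ^+ l.
  by rewrite -exprMn mulrBr mulfV // mulr1.
ring.
Qed.

(* H_k is a polynomial (with integer coefficients) p, i.e. p(x) = H_k(x) for
   every nonzero x, and its coefficient sequence is unimodal. *)
Theorem theorem3p4 (k : nat) :
  exists p : {poly int},
    (forall x : rat, x != 0 -> (map_poly (intr : int -> rat) p).[x] = Hk k x) /\
    unimodal p.
Proof.
exists (polyH k); split; first exact: polyH_horner.
exact/descents_persist_unimodal/polyH_descents.
Qed.
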